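(* As the integer $r$ tends to $+\infty$, we have \[M(r)\sim\frac{\log r}{r},\] that is, $\lim_{r\to+\infty} \frac{rM(r)}{\log r}=1$.
   Context: For a positive integer $n$, $M(n):=\frac{1}{\varphi(n)}\sum_{1\leq\ell\leq n,\ \gcd(\ell,n)=1}\frac{1}{\ell}$, where $\varphi$ denotes the Euler totient function. $\log$ is the natural logarithm. *)

(* Defs.v *)
From HB Require Import structures.
From mathcomp Require Import all_boot all_order all_algebra.
From mathcomp Require Import all_classical all_reals all_analysis.
Import Order.TTheory GRing.Theory Num.Theory.
Import numFieldNormedType.Exports.

Set Implicit Arguments.
Unset Strict Implicit.
Unset Printing Implicit Defensive.

Local Open Scope ring_scope.

Definition M (R : realType) (n : nat) : R :=
  (totient n)%:R^-1 * \sum_(1 <= l < n.+1 | gcdn l n == 1%N) l%:R^-1.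
Arguments M : clear implicits.

(* Main.v *)
Require Import Defs.
From HB Require Import structures.
From mathcomp Require Import all_boot all_order all_algebra.
From mathcomp Require Import all_classical all_reals all_analysis.
From mathcomp Require Import ring lra.
Import Order.TTheory GRing.Theory Num.Theory.
Import numFieldNormedType.Exports.

Local Open Scope classical_set_scope.
Local Open Scope ring_scope.

(** Write [phi] for the totient, [T(ps, m)] for [sieved_sum ps m], the sum of
    [1/l] over the [l <= m] that no prime of [ps] divides, [H(m)] for the
    harmonic sum [T([::], m)], and [P] for [phi(n)/n], the product of
    [1 - 1/p] over the primes [p] dividing [n].  Since
    [n M(n) = T(primes n, n) / P], one must show that [T(primes n, n)] is
    asymptotic to [P log n].

    Sorting the [l <= m] by divisibility by a prime [p] outside [ps] gives
    [T(ps, m) = T(p :: ps, m) + (1/p) T(ps, m/p)] ([sieved_sum_cons]), and both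
    bounds come from this recurrence alone.

    Lower bound: as [T(ps, m/p) <= T(ps, m)], each prime costs at most a factor
    [1 - 1/p], so [T(primes n, n) >= P H(n) >= P log n] with no error term
    ([sieved_sum_lower]).

    Upper bound: every positive integer is uniquely [a l] with [a] composed of primes
    dividing [n] and [l] coprime to [n].  Hence, for any [A], the product of
    [T(primes n, n)] with the sum of [1/a] over such [a <= A] is at most
    [H(A n) <= 1 + log A + log n].  The sum of [1/a] over all such [a] is
    [1/P], and under the probability weights [P/a] the mean of [log a] is
    the sum [f] of [log p / (p - 1)] over [p] dividing [n]; Markov's inequality then
    bounds the part with [a > A] by a proportion [f / log A].  Therefore
    [T(primes n, n) (1 - f / log A) <= P (1 + log A + log n)].
    [sieved_sum_upper] carries out this argument directly by induction on the
    set of primes, without summing over the [a].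

    Primes [p <= k] contribute at most [k] to [f] and the others at most
    [(log n) / k] because their product divides [n] ([log_moment_primes_le]), so
    [f = o(log n)].  Taking [A = n^d] for a small fixed [d] makes the upper
    bound [(1 + O(d)) P log n]. *)

(** * Harmonic sums over sieved integers *)

Definition sieved (ps : seq nat) (l : nat) : bool :=
  all (fun p => ~~ (p %| l)%N) ps.

Definition sieved_sum {R : realType} (ps : seq nat) (m : nat) : R :=
  \sum_(1 <= l < m.+1 | sieved ps l) l%:R^-1.

Definition euler_prod {R : realType} (ps : seq nat) : R :=
  \prod_(p <- ps) (1 - p%:R^-1).

(** The mean of [log a] when [a] ranges over the integers composed of primes in
    [ps], with probability proportional to [1/a]. *)
Definition log_moment {R : realType} (ps : seq nat) : R :=
  \sum_(p <- ps) ln p%:R / (p%:R - 1).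

Lemma sieved_sum_ge0 (R : realType) ps m : 0 <= sieved_sum ps m :> R.
Proof. by apply: sumr_ge0 => l _; rewrite invr_ge0 ler0n. Qed.

Lemma le_sieved_sum (R : realType) ps m n : (m <= n)%N ->
  sieved_sum ps m <= sieved_sum ps n :> R.
Proof.
move=> le_mn; rewrite /sieved_sum [leRHS](big_cat_nat _ (n := m.+1))//=.
by rewrite lerDl sumr_ge0// => l _; rewrite invr_ge0 ler0n.
Qed.

Lemma sum_multiples (R : realType) (p m : nat) (Q : pred nat) (F : nat -> R) :
  (0 < p)%N ->
  \sum_(1 <= l < m.+1 | (p %| l)%N && Q l) F l =
  \sum_(1 <= k < (m %/ p).+1 | Q (p * k)%N) F (p * k)%N.
Proof.
move=> p0; elim: m => [|m IH]; first by rewrite div0n !big_nil.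
rewrite big_mkcond big_nat_recr//= -big_mkcond IH divnS//.
have [pm|pm] /= := boolP (p %| m.+1)%N; last by rewrite add0n addr0.
rewrite add1n [RHS]big_mkcond [RHS]big_nat_recr//= -big_mkcond.
suff -> : (p * (m %/ p).+1)%N = m.+1 by [].
by rewrite -(divnK pm) divnS// pm add1n mulnC.
Qed.

Lemma sieved_mul p (ps : seq nat) k : prime p -> all prime ps -> p \notin ps ->
  sieved ps (p * k) = sieved ps k.
Proof.
move=> pp /allP aps nps; apply: eq_in_all => q qps.
have pq := aps _ qps.
rewrite Euclid_dvdM// dvdn_prime2//.
by case: eqP => // qp; rewrite -qp qps in nps.
Qed.

(** The terms divisible by [p] are the [p * k] with [k <= m %/ p], and sieving
    [p * k] by other primes amounts to sieving [k]. *)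
Lemma sieved_sum_cons (R : realType) p (ps : seq nat) m :
  prime p -> all prime ps -> p \notin ps ->
  sieved_sum ps m =
  sieved_sum (p :: ps) m + p%:R^-1 * sieved_sum ps (m %/ p) :> R.
Proof.
move=> pp aps nps.
rewrite /sieved_sum (bigID (fun l => (p %| l)%N))/= addrC; congr (_ + _).
  by apply: eq_bigl => l; rewrite andbC.
under eq_bigl do rewrite andbC.
rewrite sum_multiples ?prime_gt0// mulr_sumr.
under eq_bigl do rewrite sieved_mul//.
by apply: eq_bigr => k _; rewrite natrM invfM.
Qed.

(** * Bounds by induction on the set of primes *)

Lemma subr_inv_prime_ge0 (R : realType) p : prime p -> 0 <= 1 - p%:R^-1 :> R.
Proof.
by move=> pp; rewrite subr_ge0 invf_le1 ?ler1n ?ltr0n prime_gt0.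
Qed.

Lemma euler_prod_ge0 (R : realType) (ps : seq nat) : all prime ps ->
  0 <= euler_prod ps :> R.
Proof.
move=> /allP aps; rewrite /euler_prod big_seq prodr_ge0// => p /aps.
exact: subr_inv_prime_ge0.
Qed.

(** Each new prime [p] removes [p^-1 * sieved_sum ps (m %/ p)], and bounding
    this by [p^-1 * sieved_sum ps m] costs only monotonicity, so that every
    prime contributes at worst its Euler factor. *)
Lemma sieved_sum_lower (R : realType) (ps : seq nat) m :
  all prime ps -> uniq ps ->
  euler_prod ps * sieved_sum [::] m <= sieved_sum ps m :> R.
Proof.
elim: ps => [|p ps IH] /=; first by rewrite /euler_prod big_nil mul1r.
move=> /andP[pp aps] /andP[nps ups]; rewrite /euler_prod big_cons -mulrA.
apply: le_trans (ler_wpM2l (subr_inv_prime_ge0 R _ pp) (IH aps ups)) _.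
rewrite mulrBl mul1r lerBlDr [leLHS](sieved_sum_cons R p)// lerD2l.
by rewrite ler_wpM2l ?invr_ge0// le_sieved_sum// leq_div.
Qed.

Lemma eq_sieved_sum (R : realType) (ps qs : seq nat) m : ps =i qs ->
  sieved_sum ps m = sieved_sum qs m :> R.
Proof. by move=> e; apply: eq_bigl => l; apply: eq_all_r. Qed.

Lemma log_moment_ge0 (R : realType) (ps : seq nat) : all prime ps ->
  0 <= log_moment ps :> R.
Proof.
move=> /allP aps; rewrite /log_moment big_seq; apply: sumr_ge0 => p /aps pp.
have p1 : 1 <= p%:R :> R by rewrite ler1n prime_gt0.
by rewrite divr_ge0 ?ln_ge0// subr_ge0.
Qed.

(** The first-moment bound, in a form that passes from [qs] to [p :: qs].
    Without primes in [qs] it is Markov's inequality for one integer: the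
    indicator of [n <= m] is at least [ln ((m + 1) / n) / L].  Adding [p] to
    [qs] replaces the sieved sum over [p :: rs] by the one over [rs], that is,
    sums over the powers of [p] which may occur in the smooth part; unrolling
    this geometric sum one step at a time is the inner induction on [m].  It
    divides the bound by [1 - 1/p] and shifts the logarithm by the mean
    [ln p / (p - 1)] of [j ln p] under the weights [p ^ -j].  The logarithm
    of [m.+1] rather than [m] absorbs the floor, as
    [(m %/ p).+1 >= m.+1 / p]. *)
Lemma sieved_sum_upper (R : realType) (n : nat) (L : R) (qs rs : seq nat) m :
  (0 < n)%N -> 0 <= L -> all prime (qs ++ rs) -> uniq (qs ++ rs) ->
  ln m.+1%:R - ln n%:R <= L ->
  sieved_sum (qs ++ rs) n * (ln m.+1%:R - ln n%:R - log_moment qs) <=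
  L * euler_prod qs * sieved_sum rs m.
Proof.
move=> n0 L0; elim: qs rs m => [|p qs IH] rs m.
  move=> _ _ mL; rewrite /log_moment /euler_prod !big_nil subr0 mulr1 /=.
  have [nm|mn] := leqP n m.
    apply: le_trans (ler_wpM2l (sieved_sum_ge0 R rs n) mL) _.
    by rewrite mulrC ler_wpM2l// le_sieved_sum.
  apply: (@le_trans _ _ 0); last by rewrite mulr_ge0// sieved_sum_ge0.
  rewrite mulr_ge0_le0 ?sieved_sum_ge0// subr_le0 ler_ln ?posrE ?ltr0n//.
  by rewrite ler_nat.
move=> /=/andP[pp aps] /andP[nps ups].
have p1 : 1 < p%:R :> R by rewrite ltr1n prime_gt1.
have aps' : all prime (qs ++ p :: rs).
  by move: aps; rewrite !all_cat /= pp.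
have ups' : uniq (qs ++ p :: rs).
  by rewrite -cat1s uniq_catCA /= nps.
have prs : p \notin rs by move: nps; rewrite mem_cat negb_or => /andP[].
have ars : all prime rs by move: aps; rewrite all_cat => /andP[].
have -> : sieved_sum (p :: qs ++ rs) n = sieved_sum (qs ++ p :: rs) n :> R.
  by apply: eq_sieved_sum => q; rewrite !(inE, mem_cat) orbCA.
elim/ltn_ind: m => m IHm mL.
have [m0|m0] := posnP m.
  apply: (@le_trans _ _ 0); last first.
    rewrite !mulr_ge0 ?sieved_sum_ge0//.
    by rewrite euler_prod_ge0//= pp; move: aps; rewrite all_cat => /andP[].
  rewrite m0 ln1 mulr_ge0_le0 ?sieved_sum_ge0// sub0r -opprD oppr_le0.
  rewrite addr_ge0 ?ln_ge0 ?ler1n// log_moment_ge0//= pp.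
  by move: aps; rewrite all_cat => /andP[].
(* [m] splits into multiples of [p], bounded through [m %/ p], and the rest,
   bounded by the outer induction; they enter with weights [p^-1] and
   [1 - p^-1]. *)
have h1 := IH (p :: rs) m aps' ups' mL.
have h2 := IHm (m %/ p)%N (ltn_Pdiv (prime_gt1 pp) m0).
have le_div : ln (m %/ p).+1%:R <= ln m.+1%:R :> R.
  by rewrite ler_ln ?posrE ?ltr0n// ler_nat ltnS leq_div.
have ge_div : ln m.+1%:R - ln p%:R <= ln (m %/ p).+1%:R :> R.
  rewrite lerBlDr -lnM ?posrE ?ltr0n ?(prime_gt0 pp)//.
  rewrite ler_ln ?posrE ?mulr_gt0 ?ltr0n ?(prime_gt0 pp)//.
  by rewrite -natrM ler_nat ltn_ceil// prime_gt0.
have {}h2 := h2 (le_trans (lerB le_div (lexx _)) mL).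
have c0 := sieved_sum_ge0 R (qs ++ p :: rs) n.
have rec := sieved_sum_cons R p rs m pp ars prs.
have v0 : 0 <= p%:R^-1 :> R by rewrite invr_ge0.
have v1 := subr_inv_prime_ge0 R p pp.
(* Equivalently, [w = ln p / (p - 1)] solves [w = (ln p + w) / p], which is why
   this shift reproduces itself in the step from [m %/ p] to [m]. *)
have vlp : p%:R^-1 * ln p%:R = ln p%:R / (p%:R - 1) * (1 - p%:R^-1) :> R.
  by field; rewrite subr_eq0 !gt_eqF// (lt_trans _ p1).
move: h2; rewrite rec /log_moment /euler_prod !big_cons.
rewrite -/(log_moment qs) -/(euler_prod qs).
move: h1 ge_div c0 v0 v1 vlp {IH IHm rec le_div mL}.
move: (sieved_sum (p :: rs) m) (sieved_sum rs (m %/ p)) => T1 T2.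
move: (sieved_sum _ n) (ln m.+1%:R) (ln (m %/ p).+1%:R) (ln n%:R) => c lm la ln'.
move: (ln p%:R / _) => w; move: (ln p%:R) p%:R^-1 => lp v.
move: (log_moment _) (euler_prod _) => f P h1 ge_div c0 v0 v1 vlp h2.
have ge_shift := lerB (lerB ge_div (lexx ln')) (lexx (w + f)).
have h2' := le_trans (ler_wpM2l c0 ge_shift) h2.
have := lerD (ler_wpM2l v1 h1) (ler_wpM2l v0 h2').
rewrite [leLHS](_ : _ = c * (lm - ln' - f - v * lp - v * w)); last by ring.
rewrite vlp => h; lra.
Qed.

(** * Estimates for the harmonic sum, the totient and the logarithmic moment *)

Lemma harmonic_ge_ln (R : realType) m : ln m.+1%:R <= sieved_sum [::] m :> R.
Proof.
elim: m => [|m IH]; first by rewrite ln1 sieved_sum_ge0.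
rewrite /sieved_sum big_nat_recr//= -/(sieved_sum [::] m).
have -> : m.+2%:R = m.+1%:R * (1 + m.+1%:R^-1) :> R.
  by rewrite mulrDr mulr1 divff ?pnatr_eq0// -natr1.
rewrite lnM ?posrE ?ltr0n ?addr_gt0 ?invr_gt0 ?ltr0n//; apply: lerD => //.
by apply: le_ln1Dx; rewrite (lt_trans (_ : _ < 0)) ?invr_gt0 ?ltr0n// ltrN10.
Qed.

Lemma harmonic_le_ln (R : realType) m : (0 < m)%N ->
  sieved_sum [::] m <= 1 + ln m%:R :> R.
Proof.
case: m => // m _; elim: m => [|m IH].
  by rewrite /sieved_sum big_nat1 invr1 ln1 addr0.
rewrite /sieved_sum big_nat_recr//= -/(sieved_sum [::] m.+1).
have := lerD IH (lexx (m.+2%:R^-1)); move=> /le_trans; apply.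
rewrite -addrA lerD2l.
have e : m.+1%:R = m.+2%:R * (1 + - m.+2%:R^-1) :> R.
  by rewrite mulrBr mulr1 divff ?pnatr_eq0// -[m.+2%:R]natr1 addrK.
have p : 0 < 1 + - m.+2%:R^-1 :> R.
  by rewrite subr_gt0 invf_lt1 ?ltr1n ?ltr0n.
rewrite [X in ln X + _]e lnM ?posrE ?ltr0n//.
by rewrite -addrA gerDl -lerBrDr sub0r; apply: le_ln1Dx;
   rewrite -subr_gt0 opprK addrC.
Qed.

Lemma prod_primes_dvdn n : (0 < n)%N -> (\prod_(p <- primes n) p %| n)%N.
Proof.
move=> n0; rewrite {2}(prod_prime_decomp n0) prime_decompE big_map /=.
rewrite big_seq [X in (_ %| X)%N]big_seq.
elim/big_ind2: _ => // [m1 m2 n1 n2|p pn]; first exact: dvdn_mul.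
by rewrite -{1}(expn1 p) dvdn_exp2l// logn_gt0.
Qed.

Lemma ln_prod_primes (R : realType) (s : seq nat) : all prime s ->
  ln (\prod_(p <- s) p)%N%:R = \sum_(p <- s) ln p%:R :> R.
Proof.
elim: s => [|p s IH] /=; first by rewrite !big_nil ln1.
move=> /andP[pp ps]; rewrite !big_cons natrM lnM ?IH//
  posrE ltr0n ?(prime_gt0 pp)//.
rewrite big_seq; apply: prodn_cond_gt0 => q qs; exact/prime_gt0/(allP ps).
Qed.

Lemma totient_euler_prod (R : realType) n : (0 < n)%N ->
  (totient n)%:R = n%:R * euler_prod (primes n) :> R.
Proof.
move=> n0.
have -> : n%:R = \prod_(p <- primes n) p%:R ^+ logn p n :> R.
  rewrite {1}(prod_prime_decomp n0) prime_decompE big_map natr_prod.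
  by apply: eq_bigr => p _; rewrite natrX.
rewrite totientE// natr_prod /euler_prod -big_split /= big_seq [RHS]big_seq.
apply: eq_bigr => p; rewrite -logn_gt0 => pn.
have p0 : (0 < p)%N.
  by move: pn; rewrite logn_gt0 mem_primes => /andP[/prime_gt0].
rewrite natrM natrX -subn1 natrB// -{2}(prednK pn) exprS.
by field; rewrite pnatr_eq0 -lt0n.
Qed.

Lemma M_sieved_sum (R : realType) n : (0 < n)%N ->
  M R n = (totient n)%:R^-1 * sieved_sum (primes n) n.
Proof.
move=> n0; rewrite /M; congr (_ * _); apply: congr_big_nat => // l /andP[l0 _].
have l0' : (0 < l)%N by [].
rewrite -[_ == _]/(coprime l n) coprime_has_primes//.
rewrite /sieved -all_predC; apply: eq_in_all => p pn /=.
by rewrite mem_primes l0' /=; move: pn; rewrite mem_primes => /andP[->].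
Qed.

(** For [p <= k] use [ln p <= p - 1]; for [p > k] use [p - 1 >= k] together with
    the divisibility of [n] by the product of its primes.  As [k] is free, this
    makes the moment negligible compared with [ln n]. *)
Lemma log_moment_primes_le (R : realType) n k : (0 < n)%N -> (0 < k)%N ->
  log_moment (primes n) <= k%:R + ln n%:R / k%:R :> R.
Proof.
move=> n0 k0.
have count_le : (count (fun p => p <= k)%N (primes n) <= k)%N.
  rewrite -size_filter -[leqRHS](size_iota 1).
  apply: uniq_leq_size; first by rewrite filter_uniq// primes_uniq.
  move=> p; rewrite mem_filter mem_iota mem_primes => /and3P[pk pp _].
  by rewrite (prime_gt0 pp) add1n ltnS.
have prod_le : \sum_(p <- primes n) ln p%:R <= ln n%:R :> R.
  rewrite -ln_prod_primes ?all_prime_primes//.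
  have dv := prod_primes_dvdn n n0.
  by rewrite ler_ln ?posrE ?ltr0n ?(dvdn_gt0 n0 dv)// ler_nat dvdn_leq.
apply: (@le_trans _ _
    (\sum_(p <- primes n) ((p <= k)%N%:R + ln p%:R / k%:R))); last first.
  rewrite big_split /= -mulr_suml lerD//.
    rewrite -natr_sum ler_nat; apply: leq_trans count_le.
    by rewrite -sum1_count [leqRHS]big_mkcond leq_sum// => p _; case: leqP.
  by rewrite ler_wpM2r ?invr_ge0.
rewrite /log_moment big_seq [leRHS]big_seq; apply: ler_sum => p.
rewrite mem_primes => /andP[pp _].
have p1 : 0 < p%:R - 1 :> R by rewrite subr_gt0 ltr1n prime_gt1.
have lp0 : 0 <= ln p%:R :> R by rewrite ln_ge0// ler1n prime_gt0.
have [pk|kp] := leqP p k.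
  rewrite -[leLHS]addr0 lerD ?divr_ge0// ler_pdivrMr// mul1r.
  by rewrite -{1}[p%:R](subrKC 1) le_ln1Dx// (lt_trans _ p1)// ltrN10.
rewrite add0r ler_wpM2l// lef_pV2 ?posrE ?ltr0n//.
by rewrite lerBrDr natr1 ler_nat.
Qed.

(** * The asymptotic formula *)

(** The case [qs = primes n], [rs = [::]] of [sieved_sum_upper] at
    [m = floor (n ^ (1 + d))], where the right-hand side is a harmonic sum. *)
Lemma sieved_sum_primes_upper (R : realType) n (d : R) : (1 < n)%N -> 0 < d ->
  sieved_sum (primes n) n * (d * ln n%:R - log_moment (primes n)) <=
  d * ln n%:R * euler_prod (primes n) * (1 + (1 + d) * ln n%:R).
Proof.
move=> n1 d0; have n0 : (0 < n)%N by exact: ltnW.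
have x0 : 0 < ln n%:R :> R by rewrite ln_gt0// ltr1n.
set x := ln n%:R in x0 *; have dx0 : 0 < d * x by rewrite mulr_gt0.
have nR0 : 0 < n%:R :> R by rewrite ltr0n.
pose y := n%:R * expR (d * x); have y0 : 0 < y by rewrite mulr_gt0 ?expR_gt0.
have lny : ln y = (1 + d) * x.
  by rewrite lnM ?posrE ?expR_gt0// expRK mulrDl mul1r.
have /andP[my ym] := truncn_itv (ltW y0).
set m := Num.truncn y in my ym.
have m0 : (0 < m)%N.
  rewrite truncn_gt0 -[1]mul1r ler_pM ?ler1n//.
  by rewrite -expR0 ler_expR ltW.
set L := ln m.+1%:R - x : R.
have dxL : d * x <= L.
  rewrite lerBrDr (_ : _ + x = ln y); last by rewrite lny; ring.
  by rewrite ler_ln ?posrE ?ltr0n// ltW.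
have L0 : 0 < L by exact: lt_le_trans dxL.
have := @sieved_sum_upper R n L (primes n) [::] m n0 (ltW L0).
rewrite cats0 all_prime_primes primes_uniq => /(_ isT isT (lexx _)).
have harm : sieved_sum [::] m <= 1 + (1 + d) * x.
  apply: le_trans (harmonic_le_ln R m m0) _.
  by rewrite lerD2l -lny ler_ln ?posrE ?ltr0n.
have P0 : 0 <= euler_prod (primes n) :> R.
  exact: euler_prod_ge0 (all_prime_primes n).
have f0 : 0 <= log_moment (primes n) :> R.
  exact: log_moment_ge0 (all_prime_primes n).
have T0 := sieved_sum_ge0 R (primes n) n.
rewrite -/x -/L.
move: (sieved_sum _ n) (log_moment _) (euler_prod _) (sieved_sum _ m) T0 f0 P0 harm.
move=> T f P H T0 f0 P0 harm up.
(* Rounding makes [L] slightly larger than [d * x]; since [f >= 0], the factor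
   [1 - f / L] only decreases when [L] is replaced by [d * x]. *)
rewrite -(ler_pM2r L0).
apply: (@le_trans _ _ (d * x * (T * (L - f)))).
  rewrite [leRHS](_ : _ = T * (d * x * L - f * (d * x))); last by ring.
  rewrite [leLHS](_ : _ = T * (d * x * L - f * L)); last by ring.
  by rewrite ler_wpM2l// lerB// ler_wpM2l.
apply: (@le_trans _ _ (d * x * (L * P * H))).
  by rewrite ler_wpM2l ?(ltW dx0).
rewrite [leRHS](_ : _ = d * x * (L * P * (1 + (1 + d) * x))); last by ring.
by rewrite ler_wpM2l ?(ltW dx0)// ler_wpM2l// mulr_ge0 ?(ltW L0).
Qed.

(** The hypotheses on [k] and [n] make the moment at most [2 d^2 ln n] and the
    constant [1] at most [d ln n], so the upper bound becomes
    [(1 + 2 d) / (1 - 2 d)], which is at most [1 + 8 d] for [d <= 1/4]. *)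
Lemma normalized_M_bounds (R : realType) n k (d : R) : (1 < n)%N -> (0 < k)%N ->
    0 < d -> d <= 1 / 4 -> d ^- 2 <= k%:R -> k%:R / d ^+ 2 <= ln n%:R ->
  1 <= n%:R * M R n / ln (n%:R : R) <= 1 + 8 * d.
Proof.
move=> n1 k0 d0 d4 kd xk; have n0 : (0 < n)%N by exact: ltnW.
have x0 : 0 < ln n%:R :> R by rewrite ln_gt0// ltr1n.
have P0 : 0 < euler_prod (primes n) :> R.
  by rewrite -(pmulr_rgt0 _ (_ : 0 < n%:R)) -?totient_euler_prod ?ltr0n
    ?totient_gt0.
have lower : euler_prod (primes n) * ln n%:R <= sieved_sum (primes n) n :> R.
  apply: le_trans (sieved_sum_lower R _ n (all_prime_primes n) (primes_uniq n)).
  rewrite ler_pM2l//; apply: le_trans (harmonic_ge_ln R n).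
  by rewrite ler_ln ?posrE ?ltr0n// ler_nat.
have upper := sieved_sum_primes_upper R n d n1 d0.
have fle := log_moment_primes_le R n k n0 k0.
rewrite M_sieved_sum// totient_euler_prod//.
set u := (X in _ <= X <= _).
have Tu : sieved_sum (primes n) n = u * (euler_prod (primes n) * ln n%:R).
  by rewrite /u; field; rewrite pnatr_eq0 -lt0n n0 !gt_eqF.
move: lower upper; rewrite Tu {Tu}; move: u => u.
rewrite -{1}[_ * ln _]mul1r ler_pM2r ?mulr_gt0// => u1 upper.
rewrite u1 /=.
have d20 : 0 < d ^+ 2 by rewrite exprn_gt0.
have k0' : 0 < k%:R :> R by rewrite ltr0n.
move: fle upper xk kd x0 P0.
move: (ln _) (log_moment _) (euler_prod _) => x f P fle upper xk kd x0 P0.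
have kx : k%:R <= d ^+ 2 * x by rewrite mulrC -ler_pdivrMr.
have xk' : x / k%:R <= d ^+ 2 * x.
  by rewrite mulrC ler_pM2r// -[d ^+ 2]invrK lef_pV2 ?posrE ?invr_gt0.
have dx1 : 1 <= d * x.
  have k1 : 1 <= k%:R :> R by rewrite ler1n.
  have : d ^+ 2 * x <= d * x.
    by rewrite ler_pM2r// expr2 -[leRHS]mulr1 ler_pM2l//; lra.
  lra.
have {}upper : u * (d * x - f) <= d * (1 + (1 + d) * x).
  rewrite -(ler_pM2r (mulr_gt0 P0 x0)).
  by move: upper; congr (_ <= _); ring.
have {}upper : u * (d * x * (1 - 2 * d)) <= d * x * (1 + 2 * d).
  apply: (le_trans (y := u * (d * x - f))).
    by rewrite ler_pM2l ?(lt_le_trans _ u1)//; lra.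
  apply: le_trans upper _.
  by rewrite -mulrA ler_pM2l//; lra.
have dx0 : 0 < d * x by rewrite mulr_gt0.
move: upper; rewrite mulrCA ler_pM2l// => upper.
rewrite -(ler_pM2r (_ : 0 < 1 - 2 * d)); last by lra.
apply: le_trans upper _.
have : d * d <= d * (1 / 4) by rewrite ler_pM2l.
lra.
Qed.

Theorem corollary1p4 (R : realType) :
  (fun r : nat => r%:R * M R r / ln (r%:R : R)) @ \oo --> (1 : R).
Proof.
apply/cvgrPdist_le => e e0.
pose d : R := Num.min (1 / 4) (e / 8).
have d0 : 0 < d by rewrite lt_min; apply/andP; split; lra.
have d4 : d <= 1 / 4 by rewrite ge_min lexx.
have de : 8 * d <= e by rewrite mulrC -ler_pdivlMr// ge_min lexx orbT.
pose k := (Num.truncn (d ^- 2)).+1.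
have kd : d ^- 2 <= k%:R by exact/ltW/truncnS_gt.
near=> n.
have n1 : (1 < n)%N by near: n; exact: nbhs_infty_gt.
have xk : k%:R / d ^+ 2 <= ln n%:R :> R.
  rewrite -ler_expR lnK ?posrE ?ltr0n ?(ltnW n1)//.
  by near: n; exact: nbhs_infty_ger.
have /andP[lo up] := normalized_M_bounds R n k d n1 isT d0 d4 kd xk.
rewrite ler0_norm ?subr_le0// opprB lerBlDl.
by apply: le_trans up _; rewrite lerD2l.
Unshelve. all: by end_near.
Qed.
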